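(* Let $\omega$ be a Cayley permutation of length at least two. Then there is a unique simple Cayley permutation $\sigma$ of length $k\geq 2$ such that $$\omega=\sigma[\alpha_1,\ldots,\alpha_k]$$ for some nonempty Cayley permutations $\alpha_1,\ldots,\alpha_k$ satisfying the restriction that $\alpha_i=1$ whenever $|\sigma^{-1}(\sigma(i))|>1$. If $\sigma\notin\{12,21\}$, then the components $\alpha_i$ are uniquely determined. If $\sigma=12$, they are unique if we require $\alpha_1$ to be plus indecomposable. If $\sigma=21$, they are unique if we require $\alpha_1$ to be minus indecomposable.
   Context: Write $[n]=\{1,\ldots,n\}$. A Cayley permutation of length $n$ is a word $\omega=w_1\cdots w_n$ of positive integers whose set of letters is $[m]$ for some $m\leq n$ (the empty word is allowed for $n=0$); equivalently a map $\omega:[n]\to[n]$, $\omega(i)=w_i$, with image $[m]$, and $\max(\omega)=m$. Let $\mathrm{Cay}_n$ be the set of Cayley permutations of length $n$. A nonempty interval of positions $I=[a,b]\subseteq[n]$ is an H-interval of $\omega\in\mathrm{Cay}_n$ if there is an interval of values $J=[c,d]$ with $\omega(I)=J$ and $\omega^{-1}(J)=I$. $\omega\in\mathrm{Cay}_n$ is simple if every H-interval of $\omega$ is a singleton or equals $[n]$. Inflation: let $\sigma\in\mathrm{Cay}_k$ and let $\alpha_1,\ldots,\alpha_k$ be nonempty Cayley permutations with $\alpha_i=1$ (the one-letter word) whenever $|\sigma^{-1}(\sigma(i))|>1$. The inflation $\sigma[\alpha_1,\ldots,\alpha_k]$ is the Cayley permutation obtained by replacing each entry $\sigma(i)$ by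 a factor order isomorphic to $\alpha_i$, every nonsingleton factor forming an H-interval, while preserving the relative order (including equality) of the entries of $\sigma$. Explicitly, with $h_j=\max(\alpha_i)$ if $\sigma^{-1}(j)=\{i\}$ and $h_j=1$ if $|\sigma^{-1}(j)|>1$, the entry $\sigma(i)$ is replaced by the word $\alpha_i$ with $h_1+\cdots+h_{\sigma(i)-1}$ added to each letter. For example $312143[1,1,221,1,12,1]=413321564$. Direct and skew sums are $\alpha\oplus\beta=12[\alpha,\beta]$ and $\alpha\ominus\beta=21[\alpha,\beta]$. A Cayley permutation is plus indecomposable if it is not a direct sum of shorter Cayley permutations, and minus indecomposable if it is not a skew sum of shorter Cayley permutations. *)

(* Defs.v *)
From mathcomp Require Import all_boot.

Set Implicit Arguments.
Unset Strict Implicit.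
Unset Printing Implicit Defensive.

(* A Cayley permutation is the word of its letters; its length is [size].     *)
(* Letters are positive integers, but positions are counted from 0.           *)
Definition cayley (w : seq nat) : Prop :=
  exists2 m, m <= size w & w =i iota 1 m.

Definition maxletter (w : seq nat) : nat := \max_(x <- w) x.

(* The nonempty interval of positions I = [a, b] is an H-interval of w: there *)
(* is an interval of values J = [c, d] with w(I) = J and w^-1(J) = I.         *)
Definition h_interval (w : seq nat) (a b : nat) : Prop :=
  a <= b < size w /\
  exists c d,
    [seq nth 0 w i | i <- index_iota a b.+1] =i [pred v | c <= v <= d] /\
    (forall i, i < size w -> (c <= nth 0 w i <= d) = (a <= i <= b)).

Definition simple_cayley (w : seq nat) : Prop :=
  cayley w /\
  forall a b, h_interval w a b -> a = b \/ (a = 0 /\ b.+1 = size w).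

Definition inflatable (sigma : seq nat) (alpha : seq (seq nat)) : Prop :=
  size alpha = size sigma /\
  forall i, i < size sigma ->
    [/\ cayley (nth [::] alpha i),
        nth [::] alpha i <> [::] &
        1 < count_mem (nth 0 sigma i) sigma -> nth [::] alpha i = [:: 1]].

(* The number of values taken up in the inflation by the value j of sigma.    *)
Definition height (sigma : seq nat) (alpha : seq (seq nat)) (j : nat) : nat :=
  if count_mem j sigma == 1 then maxletter (nth [::] alpha (index j sigma))
  else 1.

(* The inflation sigma[alpha_1, ..., alpha_k], meaningful for inflatable      *)
(* components.                                                                *)
Definition inflation (sigma : seq nat) (alpha : seq (seq nat)) : seq nat :=
  flatten
    [seq [seq x + \sum_(1 <= j < nth 0 sigma i) height sigma alpha j
         | x <- nth [::] alpha i]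
    | i <- iota 0 (size sigma)].

Definition direct_sum (a b : seq nat) : seq nat :=
  inflation [:: 1; 2] [:: a; b].

Definition skew_sum (a b : seq nat) : seq nat :=
  inflation [:: 2; 1] [:: a; b].

(* The length conditions force both summands to be nonempty.                  *)
Definition plus_indecomposable (w : seq nat) : Prop :=
  ~ exists a b, [/\ cayley a, cayley b, size a < size w, size b < size w
                  & w = direct_sum a b].

Definition minus_indecomposable (w : seq nat) : Prop :=
  ~ exists a b, [/\ cayley a, cayley b, size a < size w, size b < size w
                  & w = skew_sum a b].

Definition inflates_to (sigma : seq nat) (alpha : seq (seq nat))
    (w : seq nat) : Prop :=
  inflatable sigma alpha /\ w = inflation sigma alpha.

(* Main.v *)
(* An inflation of sigma equal to w amounts to cutting w into consecutive blocks
   such that every block of size at least two is an H-interval: sigma is then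
   the pattern of the blocks, each component is the pattern of its block, and
   the H-intervals of sigma are the H-intervals of w that are unions of blocks.
   A cutting that cannot be coarsened to fewer, but at least two, blocks gives a
   simple sigma.

   Conversely let sigma be simple. Unions and differences of overlapping
   H-intervals are H-intervals, so if sigma has length at least three, every
   proper H-interval of w lies inside one block; hence the cutting of sigma is
   coarser than any other one, and therefore unique. If sigma has length two, it
   is the pattern of the first and last letters of w. For 12 and 21 the cuttings
   of w are given by a single cut point, and the first component is
   indecomposable exactly when that cut point is the least possible one. *)

Require Import Defs.
From mathcomp Require Import all_boot zify.
From Stdlib Require Import Classical.

Set Implicit Arguments.
Unset Strict Implicit.
Unset Printing Implicit Defensive.

(** * Cayley permutations as patterns *)

Lemma cayley_gt0 w i : cayley w -> i < size w -> 0 < nth 0 w i.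
Proof.
by case=> m _ wE /(mem_nth 0); rewrite wE mem_iota => /andP[].
Qed.

Lemma cayley_down w i v : cayley w -> i < size w -> 0 < v <= nth 0 w i ->
  exists2 j, j < size w & nth 0 w j = v.
Proof.
case=> m _ wE /(mem_nth 0); rewrite wE mem_iota => /andP[_ wim] /andP[v0 vi].
by apply/nthP; rewrite wE mem_iota v0 (leq_ltn_trans vi).
Qed.

(** Order isomorphism of words. Since (i, j) and (j, i) are both covered, ties between letters
    correspond as well. *)
Definition same_order (u v : seq nat) : Prop :=
  size u = size v /\
  forall i j, i < size u -> j < size u ->
    (nth 0 u i <= nth 0 u j) = (nth 0 v i <= nth 0 v j).

Lemma same_order_sym u v : same_order u v -> same_order v u.
Proof. by case=> sz uv; split=> // i j; rewrite -sz => hi hj; rewrite uv. Qed.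

(* Induction on the letter: the letter below u_i also occurs in u, at a position
   where v is strictly smaller than v_i. *)
Lemma cayley_nth_le u v i : cayley u -> cayley v -> same_order u v ->
  i < size u -> nth 0 u i <= nth 0 v i.
Proof.
move=> cu cv [sz uv]; move En: (nth 0 u i) => n.
elim: n => [//|n IHn] in i En * => hi.
case: (posnP n) => [->|n_gt0]; first by rewrite cayley_gt0 // -sz.
have [|j hj uj] := cayley_down (v := n) cu hi; first lia.
have := IHn _ uj hj; have := uv i j hi hj; lia.
Qed.

(** Serves to reduce equalities between Cayley permutations to comparisons of letters. *)
Lemma cayley_same_order_inj u v :
  cayley u -> cayley v -> same_order u v -> u = v.
Proof.
move=> cu cv uv; apply: (@eq_from_nth _ 0) => [|i hi]; first by case: uv.
apply/eqP; rewrite eqn_leq (cayley_nth_le cu cv uv hi).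
by rewrite (cayley_nth_le cv cu (same_order_sym uv)) //; case: uv => <-.
Qed.

Definition standardize (u : seq nat) : seq nat :=
  [seq (index x (sort leq (undup u))).+1 | x <- u].

Lemma standardize_cayley u : cayley (standardize u).
Proof.
set t := sort leq (undup u).
have tu x : (x \in t) = (x \in u) by rewrite mem_sort mem_undup.
exists (size t); first by rewrite size_map size_sort size_undup.
move=> v; rewrite mem_iota; apply/mapP/idP => [[x xu ->]|hv].
  by rewrite /= add1n ltnS index_mem tu.
have hv' : v.-1 < size t by lia.
exists (nth 0 t v.-1); first by rewrite -tu mem_nth.
rewrite -/t index_uniq ?sort_uniq ?undup_uniq //; lia.
Qed.

Lemma standardize_same_order u : same_order (standardize u) u.
Proof.
rewrite /standardize; set t := sort leq (undup u).
have tu x : (x \in t) = (x \in u) by rewrite mem_sort mem_undup.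
split=> [|i j]; rewrite size_map // => hi hj.
rewrite !(nth_map 0) // ltnS.
have srt : sorted leq t by apply: sort_sorted; exact: leq_total.
have ti : nth 0 u i \in t by rewrite tu mem_nth.
have tj : nth 0 u j \in t by rewrite tu mem_nth.
have H x y : x \in t -> y \in t -> index x t <= index y t -> x <= y.
  exact: (sorted_leq_index leq_trans leqnn srt).
apply/idP/idP; first exact: H.
move=> uij; rewrite leqNgt; apply/negP => lt_ji; have ji := ltnW lt_ji;
  have uji := H _ _ tj ti ji.
have E : nth 0 u i = nth 0 u j by apply/anti_leq; rewrite uij.
by rewrite E ltnn in lt_ji.
Qed.

(** * Blocks of consecutive positions *)

(* A list s of positive numbers cuts the positions below sumn s into blocks of
   consecutive positions; block q is [start s q, start s q.+1). *)
Definition start (s : seq nat) (q : nat) : nat := sumn (take q s).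

(** [block s i] is the block containing position [i], [reshape_offset s i] the place of [i] inside
    it, and [flatten_index] goes back. *)
Notation block := reshape_index.

Lemma start0 s : start s 0 = 0.
Proof. by rewrite /start take0. Qed.

Lemma start_size s : start s (size s) = sumn s.
Proof. by rewrite /start take_size. Qed.

Lemma startS s q : start s q.+1 = start s q + nth 0 s q.
Proof.
rewrite /start; case: (ltnP q (size s)) => hq.
  by rewrite (take_nth 0) // sumn_rcons.
(* Past the end both prefixes are the whole of [s], and the default 0 of [nth] keeps the identity
   true. *)
by rewrite !take_oversize ?nth_default ?addn0 // ltnW.
Qed.

Lemma start_le s q r : q <= r -> start s q <= start s r.
Proof.
move/subnK <-; elim: (r - q) => // d IHd.
by rewrite addSn startS (leq_trans IHd) ?leq_addr.
Qed.

Lemma start_lt (s : seq nat) q r :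
  0 \notin s -> q < r <= size s -> start s q < start s r.
Proof.
move=> s0 /andP[qr rs]; apply: leq_trans (start_le s qr).
rewrite startS -addn1 leq_add2l lt0n.
by apply: contraNneq s0 => <-; rewrite mem_nth // (leq_trans qr).
Qed.

Lemma block_eq s i q : start s q <= i < start s q.+1 -> block s i = q.
Proof.
rewrite startS => hi; have -> : i = flatten_index s q (i - start s q).
  rewrite /flatten_index -/(start s q); lia.
by rewrite flatten_indexKl //; lia.
Qed.

Lemma block_bounds s i :
  i < sumn s -> start s (block s i) <= i < start s (block s i).+1.
Proof.
move=> hi; have := reshape_offsetP hi; have := reshape_indexK s i.
rewrite /flatten_index -/(start s (block s i)) startS; lia.
Qed.

Lemma block_start (s : seq nat) q :
  0 \notin s -> q < size s -> block s (start s q) = q.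
Proof. by move=> s0 hq; apply: block_eq; rewrite leqnn start_lt //= leqnn. Qed.

Lemma block_range s i x y : i < sumn s ->
  (start s x <= i < start s y) = (x <= block s i < y).
Proof.
move=> /block_bounds; set q := block s i => hb.
have h1 := @start_le s x q; have h2 := @start_le s q.+1 x.
have h3 := @start_le s y q; have h4 := @start_le s q.+1 y.
lia.
Qed.

Lemma start_lt_sumn (s : seq nat) q :
  0 \notin s -> q < size s -> start s q < sumn s.
Proof. by move=> s0 hq; rewrite -(start_size s) start_lt // hq leqnn. Qed.

(** * Order pattern of an inflation *)

(* [nthP] at type [nat], where [lia] recognizes the resulting terms. *)
Lemma nat_nthP (s : seq nat) x :
  reflect (exists2 i, i < size s & nth 0 s i = x) (x \in s).
Proof. exact: nthP. Qed.

(** Splitting [s] at [i] counts the letter once, plus its occurrences before and after [i]. This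
    turns the restriction in [inflatable] into the existence of a second position. *)
Lemma count_mem_gt1 (s : seq nat) i : i < size s ->
  reflect (exists j, [/\ j < size s, j <> i & nth 0 s j = nth 0 s i])
          (1 < count_mem (nth 0 s i) s).
Proof.
move=> hi; have Es := cat_take_drop i s; rewrite (drop_nth 0 hi) in Es.
have -> : count_mem (nth 0 s i) s =
    (count_mem (nth 0 s i) (take i s) + count_mem (nth 0 s i) (drop i.+1 s)).+1.
  by rewrite -{2}Es count_cat /= eqxx addnCA.
rewrite ltnS addn_gt0 -!has_count !has_pred1; apply: (iffP orP) => [[]|].
- case/nat_nthP => j; rewrite size_take hi => hj; rewrite nth_take // => E.
  by exists j; split=> //; lia.
- case/nat_nthP => j; rewrite size_drop nth_drop => hj E.
  by exists (i.+1 + j); split=> //; lia.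
case=> j [hj ji E]; case: (ltngtP j i) => // hji; [left|right].
  by rewrite -E -(nth_take 0 hji) mem_nth // size_take hi.
have -> : nth 0 s i = nth 0 (drop i.+1 s) (j - i.+1).
  by rewrite nth_drop subnKC.
by apply: mem_nth; rewrite size_drop ltn_sub2r // (leq_ltn_trans _ hj).
Qed.

Section Inflation.

Variables (sigma : seq nat) (alpha : seq (seq nat)).

(** The shift of the factor replacing an entry [v]: the values allotted to [v] are those above
    [offset v] and at most [offset v.+1]. *)
Definition offset (v : nat) : nat := \sum_(1 <= j < v) height sigma alpha j.

Lemma offsetS v : 0 < v -> offset v.+1 = offset v + height sigma alpha v.
Proof. by move=> v0; rewrite /offset big_nat_recr. Qed.

Lemma offset_lt u v : 0 < u < v ->
  offset u + height sigma alpha u <= offset v.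
Proof.
case/andP=> u0 uv;
  rewrite -offsetS // /offset [X in _ <= X](@big_cat_nat _ _ _ u.+1) //=.
exact: leq_addr.
Qed.

Hypothesis size_alpha : size alpha = size sigma.

Local Notation w := (inflation sigma alpha).
Local Notation s := (shape alpha).

Let factors := [seq [seq x + offset (nth 0 sigma i) | x <- nth [::] alpha i]
               | i <- iota 0 (size sigma)].

Let shape_factors : shape factors = s.
Proof.
apply: (@eq_from_nth _ 0) => [|i]; first by rewrite !size_map size_iota.
rewrite !size_map size_iota => hi; rewrite !nth_shape (nth_map 0) ?size_iota //.
by rewrite nth_iota //= size_map.
Qed.

Lemma size_inflation : size w = sumn s.
Proof. by rewrite /inflation -/factors size_flatten shape_factors. Qed.

Lemma nth_inflation i : i < sumn s ->
  nth 0 w i = nth 0 (nth [::] alpha (block s i)) (reshape_offset s i)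
              + offset (nth 0 sigma (block s i)).
Proof.
move=> hi; have hb := reshape_indexP hi; have ho := reshape_offsetP hi.
rewrite size_map size_alpha in hb.
rewrite /inflation -/factors nth_flatten shape_factors.
rewrite (nth_map 0) ?size_iota // nth_iota //= (nth_map 0) //.
by rewrite -nth_shape.
Qed.

End Inflation.

Section Inflatable.

Variables (sigma : seq nat) (alpha : seq (seq nat)).
Hypotheses (sigma_cayley : cayley sigma) (ok : inflatable sigma alpha).

Local Notation w := (inflation sigma alpha).
Local Notation s := (shape alpha).
Local Notation offset := (offset sigma alpha).

Lemma shape_inflatable : 0 \notin s.
Proof.
case: ok => sz H; apply/negP => /nat_nthP[i]; rewrite size_map => hi.
rewrite nth_shape => /size0nil; rewrite sz in hi; by case: (H i hi).
Qed.

Lemma component_bounds i j : i < size sigma -> j < size (nth [::] alpha i) ->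
  0 < nth 0 (nth [::] alpha i) j <= height sigma alpha (nth 0 sigma i).
Proof.
case: ok => sz H hi hj; have [ci _ rep] := H i hi.
rewrite (cayley_gt0 ci hj) /=.
have c0 : 0 < count_mem (nth 0 sigma i) sigma
  by rewrite -has_count has_pred1 mem_nth.
rewrite /height; case: eqP => c1; last first.
  rewrite rep in hj *; [|lia..]; by case: j hj.
(* A value occurring once has its first occurrence at [i], so its height is the maximum of the
   component [i] itself. *)
suff -> : index (nth 0 sigma i) sigma = i.
  exact: (@leq_bigmax_seq _ _ xpredT id _ (mem_nth 0 hj)).
apply/eqP/negPn/negP => /eqP ne.
have : 1 < count_mem (nth 0 sigma i) sigma.
  apply/count_mem_gt1 => //; exists (index (nth 0 sigma i) sigma).
  by rewrite index_mem nth_index mem_nth.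
by rewrite c1.
Qed.

(** Distinct letters of [sigma] are allotted disjoint ranges of values, stacked in the order of
    [sigma]. *)
Lemma inflation_le i j : i < size w -> j < size w ->
  block s i <> block s j ->
  (nth 0 w i <= nth 0 w j) =
  (nth 0 sigma (block s i) <= nth 0 sigma (block s j)).
Proof.
case: (ok) => sz H; rewrite size_inflation // => hi hj ne.
have bi := reshape_indexP hi; have bj := reshape_indexP hj.
have oi := reshape_offsetP hi; have oj := reshape_offsetP hj.
rewrite size_map sz in bi bj; rewrite !nth_shape in oi oj.
rewrite !nth_inflation //.
have := component_bounds bi oi; have := component_bounds bj oj.
have := cayley_gt0 sigma_cayley bi; have := cayley_gt0 sigma_cayley bj.
case: (ltngtP (nth 0 sigma (block s i)) (nth 0 sigma (block s j))) => h.
- have := @offset_lt sigma alpha (nth 0 sigma (block s i)) (nth 0 sigma (block s j)); lia.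
- have := @offset_lt sigma alpha (nth 0 sigma (block s j)) (nth 0 sigma (block s i)); lia.
(* When the letters of [sigma] agree, that value is repeated, so both components are the one-letter
   word and the letters of [w] agree. *)
have one k q : k < size sigma -> q < size sigma -> k <> q ->
    nth 0 sigma q = nth 0 sigma k -> nth [::] alpha k = [:: 1].
  move=> hk hq nkq E; have [_ _] := H k hk; apply; apply/count_mem_gt1 => //.
  by exists q; split=> // /esym.
have Ei := one _ _ bi bj ne (esym h).
have Ej := one _ _ bj bi (nesym ne) h.
rewrite Ei in oi *; rewrite Ej in oj *; rewrite h.
by case: (reshape_offset s i) oi; case: (reshape_offset s j) oj => //;
  rewrite !leqnn.
Qed.

Lemma cayley_mem u x : cayley u -> 0 < x <= maxletter u -> x \in u.
Proof.
case=> m _ uE /andP[x0 xu]; rewrite uE mem_iota x0 /= add1n ltnS.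
apply: leq_trans xu _; apply/bigmax_leqP_seq => y.
by rewrite uE mem_iota => /andP[_]; rewrite add1n.
Qed.

Lemma height_mem i x : i < size sigma ->
  0 < x <= height sigma alpha (nth 0 sigma i) ->
  exists2 j, nth 0 sigma j = nth 0 sigma i &
    j < size sigma /\ x \in nth [::] alpha j.
Proof.
case: ok => sz H hi hx.
have c0 : 0 < count_mem (nth 0 sigma i) sigma
  by rewrite -has_count has_pred1 mem_nth.
move: hx; rewrite /height; case: eqP => c1 hx.
  exists (index (nth 0 sigma i) sigma); rewrite ?nth_index ?mem_nth //.
  have hk : index (nth 0 sigma i) sigma < size sigma
    by rewrite index_mem mem_nth.
  by split=> //; apply: cayley_mem => //; case: (H _ hk).
exists i => //; split=> //; have [_ _ ->] := H _ hi; last lia.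
by rewrite inE; lia.
Qed.

Lemma inflation_cayley : cayley w.
Proof.
case: (sigma_cayley) => m _ sE; case: (ok) => sz H.
have wE : w =i iota 1 (offset m.+1).
  move=> v; rewrite mem_iota; apply/flattenP/idP => [[u /mapP[i]]|hv].
    rewrite mem_iota /= add0n => hi {u}-> /mapP[x /nat_nthP[j hj xE] vE].
    rewrite {v}vE -{x}xE.
    have := component_bounds hi hj; have := cayley_gt0 sigma_cayley hi.
    have : nth 0 sigma i \in iota 1 m by rewrite -sE mem_nth.
    rewrite mem_iota -/(offset _) => hs.
    have := @offset_lt sigma alpha (nth 0 sigma i) m.+1; move: hs; lia.
  (* The ranges allotted to the letters 1 to [m] of [sigma] tile the values up to [offset m.+1]; [a]
     is the letter whose range contains [v]. *)
  have [a /andP[a0 am] va] : exists2 a, 0 < a <= m & offset a < v <= offset a.+1.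
    elim: m hv {sE} => [|m IHm] hv; first by rewrite /offset big_nil in hv; lia.
    case: (leqP v (offset m.+1)) => hvm; last by exists m.+1; lia.
    by case: IHm => [|a ha va]; [lia | exists a => //; lia].
  have : a \in sigma by rewrite sE mem_iota a0.
  case/nat_nthP => i hi Ei; rewrite offsetS // in va; subst a.
  case: (@height_mem i (v - offset (nth 0 sigma i)) hi) => [|j Ej [hj hx]];
    first lia.
  exists [seq x + offset (nth 0 sigma j) | x <- nth [::] alpha j].
    by apply: map_f; rewrite mem_iota.
  by rewrite Ej; apply/mapP; exists (v - offset (nth 0 sigma i));
    rewrite // subnK //; lia.
(* The maximum is at most the length because that many distinct values all occur in [w]. *)
exists (offset m.+1) => //; rewrite -(size_iota 1 (offset m.+1)).
by apply: uniq_leq_size (iota_uniq _ _) _ => v; rewrite wE.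
Qed.

End Inflatable.

(** * H-intervals and cuttings *)

(* H-intervals [x, y), half-open: a letter outside lies strictly below all the
   letters inside or strictly above all of them. Mixing < and <= covers both
   conditions, the case i = i' excluding equality. *)
Definition isolated (w : seq nat) (x y : nat) : Prop :=
  x < y <= size w /\
  forall i i' j, x <= i < y -> x <= i' < y -> j < size w -> ~~ (x <= j < y) ->
    (nth 0 w j < nth 0 w i) = (nth 0 w j <= nth 0 w i').

(** The interval of values has to run from the least to the greatest letter on [a, b]. Isolation
    keeps all other letters out of it, and every value in it occurs because [w] is Cayley. *)
Lemma h_intervalE w a b :
  cayley w -> h_interval w a b <-> isolated w a b.+1.
Proof.
move=> cw; split=> [[/andP[ab bw] [c [d [_ pre]]]]|[/andP[ab bw] iso]].
  split=> [|i i' j hi hi' hj nj]; first by rewrite ltnS ab.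
  have := pre i; have := pre i'; have := pre j hj; lia.
rewrite ltnS in ab; split; first by rewrite ab.
pose P (i : 'I_b.+1) := a <= i; pose F (i : 'I_b.+1) := nth 0 w i.
have Pmax : P ord_max by [].
case: (arg_minnP F Pmax) => lo alo lo_min;
  case: (arg_maxnP F Pmax) => hi ahi hi_max.
have bnd i : a <= i <= b -> F lo <= nth 0 w i <= F hi.
  case/andP=> ai ib; rewrite -ltnS in ib.
  by rewrite (lo_min (Ordinal ib)) //; apply: (hi_max (Ordinal ib)).
have pre i : i < size w -> F lo <= nth 0 w i <= F hi -> a <= i <= b.
  move=> hi_w hv; apply/negPn/negP => ni.
  have := iso lo hi i; have := iso hi lo i; rewrite /P in alo ahi.
  have := ltn_ord lo; have := ltn_ord hi; rewrite /F in hv; lia.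
exists (F lo), (F hi); split=> [v|i hi_w]; last first.
  by apply/idP/idP; [exact: pre | exact: bnd].
rewrite inE; apply/mapP/idP => [[i]|hv].
  by rewrite mem_index_iota ltnS => /bnd hi_v ->.
have [|||j hj vE] := @cayley_down w hi v => //.
- by apply: leq_trans bw; rewrite ltn_ord.
- case/andP: hv => lov ->; rewrite (leq_trans _ lov) // cayley_gt0 //.
  by apply: leq_trans bw; rewrite ltn_ord.
exists j => //; rewrite mem_index_iota ltnS; apply: pre => //; by rewrite vE.
Qed.

(** Every position of the union shares one of the two intervals with [x'], so an outside letter
    compares with it as with the letter at [x']. *)
Lemma isolatedU w x y x' y' : isolated w x y -> isolated w x' y' ->
  x <= x' < y -> y <= y' -> isolated w x y'.
Proof.
case=> xy iso [xy' iso'] h hy; split=> [|i i' j hi hi' hj nj]; first lia.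
have A k : x <= k < y' ->
    (nth 0 w j < nth 0 w k) = (nth 0 w j < nth 0 w x') /\
    (nth 0 w j <= nth 0 w k) = (nth 0 w j <= nth 0 w x').
  move=> hk; case: (ltnP k y) => ky.
    have := iso k x' j; have := iso x' k j; have := iso k k j;
      have := iso x' x' j; lia.
  have := iso' k x' j; have := iso' x' k j; have := iso' k k j;
    have := iso' x' x' j; lia.
have := A i hi; have := A i' hi'; have := iso x' x' j; lia.
Qed.

(* A position of the overlap [x', y) compares with those of [y, y') exactly as
   the position x does, and x lies outside [x', y'). *)
Lemma isolatedDr w x y x' y' : isolated w x y -> isolated w x' y' ->
  x < x' < y -> y < y' -> isolated w y y'.
Proof.
case=> xy iso [xy' iso'] h hy; split=> [|i i' j hi hi' hj nj]; first lia.
case: (boolP (x' <= j < y)) => hjm; last by apply: iso'; lia.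
have := iso' i i' x; have := iso x j i; have := iso j x i; have := iso x j i';
  have := iso j x i'.
lia.
Qed.

(** Mirror image of the previous argument: letters of the overlap are replaced by the one at [y],
    which is outside [x, y). *)
Lemma isolatedDl w x y x' y' : isolated w x y -> isolated w x' y' ->
  x < x' < y -> y < y' -> isolated w x x'.
Proof.
case=> xy iso [xy' iso'] h hy; split=> [|i i' j hi hi' hj nj]; first lia.
case: (boolP (x' <= j < y)) => hjm; last by apply: iso; lia.
have := iso i i' y; have := iso' y j i; have := iso' j y i; have := iso' y j i';
  have := iso' j y i'.
lia.
Qed.

Lemma simple_isolated s x y : simple_cayley s -> isolated s x y ->
  y = x.+1 \/ x = 0 /\ y = size s.
Proof.
case=> cs simp iso; case: y iso => [|b] iso; first by case: iso; lia.
by have [<-|[-> <-]] := simp x b ((h_intervalE _ _ cs).2 iso); auto.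
Qed.

(* The block lists s that are the shapes of the components of an inflation
   equal to w. *)
Definition isolating (s w : seq nat) : Prop :=
  [/\ 0 \notin s, sumn s = size w
    & forall q, q < size s -> start s q.+1 = (start s q).+1 \/
                              isolated w (start s q) (start s q.+1)].

(** Positions in a common block are left out: their order is that of the component. *)
Definition pattern_along (s sigma w : seq nat) : Prop :=
  size s = size sigma /\
  forall i j, i < size w -> j < size w -> block s i <> block s j ->
    (nth 0 w i <= nth 0 w j) =
    (nth 0 sigma (block s i) <= nth 0 sigma (block s j)).

(** A repeated letter of [sigma] has a block of one position, possibly not isolated because of the
    ties. The block of any other letter is strictly separated from the rest. *)
Lemma inflates_to_isolating sigma alpha w :
  cayley sigma -> inflates_to sigma alpha w -> isolating (shape alpha) w.
Proof.
move=> cs [ok ->]; have s0 := shape_inflatable ok; case: (ok) => sz H.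
have szw := @size_inflation _ _ sz.
split=> // q; rewrite size_map sz => hq.
have [|rep] := boolP (1 < count_mem (nth 0 sigma q) sigma).
  case: (H q hq) => _ _ /[apply] E; left.
  by rewrite startS nth_shape E addn1.
right; split=> [|i i' j hi hi' hj nj].
  rewrite start_lt // ?size_map ?sz ?leqnn //= szw -start_size.
  by apply: start_le; rewrite size_map sz.
rewrite szw in hj.
have bound k :
    start (shape alpha) q <= k < start (shape alpha) q.+1 ->
    k < sumn (shape alpha).
  case/andP=> _ hk; apply: leq_trans hk _; rewrite -start_size.
  by apply: start_le; rewrite size_map sz.
have bi := block_eq hi; have bi' := block_eq hi'.
have bj : block (shape alpha) j <> q.
  by move=> bj; move: nj; rewrite block_range // bj leqnn ltnSn.
have [li li'] := (bound i hi, bound i' hi').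
rewrite ltnNge !(inflation_le cs ok) ?szw ?bi ?bi' //; last exact: nesym.
rewrite -ltnNge ltn_neqAle; case: eqP => //= E; case/negP: rep.
have := reshape_indexP hj; rewrite size_map sz => hr.
by apply/count_mem_gt1 => //; exists (block (shape alpha) j).
Qed.

Lemma inflates_to_pattern sigma alpha w :
  cayley sigma -> inflates_to sigma alpha w ->
  pattern_along (shape alpha) sigma w.
Proof.
move=> cs [ok ->]; split; last exact: inflation_le.
by case: ok => sz _; rewrite size_map.
Qed.

Section Isolating.

Variables (s w : seq nat).
Hypothesis iso : isolating s w.

(** Allows a position to be replaced by the start of its block in comparisons between different
    blocks. *)
Lemma isolating_compare i i' j : i < size w -> i' < size w -> j < size w ->
  block s i = block s i' -> block s j <> block s i ->
  (nth 0 w i <= nth 0 w j) = (nth 0 w i' <= nth 0 w j) /\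
  (nth 0 w j <= nth 0 w i) = (nth 0 w j <= nth 0 w i').
Proof.
case: iso => s0 sz H hi hi' hj bii' nj; rewrite -sz in hi hi' hj.
have := block_bounds hi; have := block_bounds hi'; rewrite -bii'.
have := @block_range s j (block s i) (block s i).+1 hj.
have [E|[_ I]] := H _ (reshape_indexP hi); first by rewrite E => _ ? ?;
  have -> : i = i' by lia.
move=> rj bi' bi; have := I i i' j; have := I i' i j; have := I i i j;
  have := I i' i' j; lia.
Qed.

End Isolating.

(** A position inside a union of blocks and one outside it never share a block, so each comparison
    transfers between [w] and [sigma]; block starts represent the blocks. *)
Lemma isolated_pattern s sigma w x y :
  isolating s w -> pattern_along s sigma w -> x < y <= size sigma ->
  isolated sigma x y <-> isolated w (start s x) (start s y).
Proof.
move=> [s0 szw _] [szs pat] xy.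
have yn : start s y <= size w by rewrite -szw -start_size start_le //; lia.
split=> [[_ I]|[_ I]]; split.
- by rewrite yn start_lt ?szs.
- move=> i i' j hi hi' hj; have [li li'] : i < size w /\ i' < size w by lia.
  have := hi; have := hi'; rewrite !block_range ?szw // => bi' bi bj.
  have ne k : x <= k < y -> block s j <> k by move=> hk E; rewrite E hk in bj.
  rewrite ltnNge !pat //; [|exact: ne|exact/nesym/ne].
  by rewrite -ltnNge; apply: I => //; rewrite -szs reshape_indexP ?szw.
- exact: xy.
move=> i i' j hi hi' hj nj.
have L k : k < size s -> start s k < size w.
  by move=> hk; rewrite -szw start_lt_sumn.
have [li [li' lj]] : i < size s /\ i' < size s /\ j < size s by lia.
have R k : k < size s -> (start s x <= start s k < start s y) = (x <= k < y).
  by move=> hk; rewrite block_range ?szw ?L // block_start.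
have := I (start s i) (start s i') (start s j).
rewrite !R // => /(_ hi hi' (L _ lj) nj).
have ne k : x <= k < y -> j <> k by move=> hk E; rewrite E hk in nj.
rewrite ltnNge !pat ?L ?block_start //; [|exact: ne|exact/nesym/ne].
by rewrite -ltnNge.
Qed.

(** * Existence *)

Lemma size_standardize u : size (standardize u) = size u.
Proof. exact: size_map. Qed.

Lemma isolating_inflates s w : cayley w -> isolating s w ->
  exists sigma alpha,
    [/\ cayley sigma, inflates_to sigma alpha w & shape alpha = s].
Proof.
move=> cw iso; case: (iso) => s0 szw single.
(* The first letter of each block represents it in the pattern. *)
pose u := mkseq (fun q => nth 0 w (start s q)) (size s).
pose sigma := standardize u; pose alpha := map standardize (reshape s w).
have csigma : cayley sigma := standardize_cayley u.
have szu : size u = size s by rewrite size_mkseq.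
have sz_sigma : size sigma = size s by rewrite size_standardize.
have shape_rs : shape (reshape s w) = s by rewrite reshapeKl ?szw.
have shape_alpha : shape alpha = s.
  rewrite -[RHS]shape_rs /shape /alpha -map_comp.
  by apply: eq_map => v /=; rewrite size_standardize.
have nth_alpha q : q < size s ->
    nth [::] alpha q = standardize (nth [::] (reshape s w) q).
  by move=> hq; rewrite (nth_map [::]) // size_reshape.
have sigma_le q r : q < size s -> r < size s ->
    (nth 0 sigma q <= nth 0 sigma r) =
    (nth 0 w (start s q) <= nth 0 w (start s r)).
  move=> hq hr; have [_ ->] := standardize_same_order u; rewrite ?sz_sigma //.
  by rewrite !nth_mkseq.
have ok : inflatable sigma alpha.
  split=> [|q]; first by rewrite size_map size_reshape.
  rewrite sz_sigma => hq; rewrite nth_alpha //; split.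
  - exact: standardize_cayley.
  - move/(congr1 size); rewrite size_standardize -nth_shape shape_rs /= => E.
    by case/negP: s0; rewrite -E mem_nth.
  case/count_mem_gt1 => [|r [hr rq E]]; first by rewrite sz_sigma.
  rewrite sz_sigma in hr.
  have wE : nth 0 w (start s r) = nth 0 w (start s q).
    by apply/anti_leq; rewrite -!sigma_le // E leqnn.
  (* An isolated block admits no equal letter outside it, so a repeated letter of [sigma] comes from
     a block of one position. *)
  case: (single q hq) => [S1|[_ I]]; last first.
    have lt_r : start s r < sumn s by exact: start_lt_sumn.
    have hq' : start s q <= start s q < start s q.+1
      by rewrite leqnn start_lt ?leqnn.
    have nr : ~~ (start s q <= start s r < start s q.+1).
      by rewrite block_range // block_start //; lia.
    by have := I _ _ _ hq' hq' _ nr;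
      rewrite -szw lt_r wE ltnn leqnn => /(_ isT).
  have : size (nth [::] (reshape s w) q) = 1.
    by rewrite -nth_shape shape_rs; rewrite startS in S1; lia.
  by case: (nth _ _ q) => [|x [|//]] //= _; rewrite /standardize /= eqxx.
have szi : size (inflation sigma alpha) = size w.
  by rewrite size_inflation ?shape_alpha //; case: ok.
exists sigma, alpha; split=> //; split=> //.
apply: cayley_same_order_inj => //; first exact: inflation_cayley.
split=> // i j hi hj.
have [hi' hj'] : i < sumn s /\ j < sumn s by rewrite szw.
have bi := reshape_indexP hi'; have bj := reshape_indexP hj'.
case: (eqVneq (block s i) (block s j)) => [E|/eqP ne].
  have nth_w k : k < sumn s ->
      nth 0 w k =
      nth 0 (nth [::] (reshape s w) (block s k)) (reshape_offset s k).
    move=> hk; rewrite -{1}(@reshapeKr _ s w) ?szw // nth_flatten.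
    by rewrite !shape_rs.
  have szo k : k < sumn s ->
      reshape_offset s k < size (nth [::] (reshape s w) (block s k)).
    by move=> /reshape_offsetP; rewrite -nth_shape shape_rs.
  rewrite !nth_w // !nth_inflation ?shape_alpha //; try by case: ok.
  rewrite -E leq_add2r nth_alpha //; set v := nth _ (reshape s w) _.
  by have [_ ->] := standardize_same_order v;
    rewrite ?size_standardize ?szo // /v ?E ?szo.
rewrite (@inflation_le sigma alpha) ?shape_alpha ?szi // sigma_le //.
have Sw q : q < size s -> start s q < size w by move=> hq;
  rewrite -szw start_lt_sumn.
have [-> _] := isolating_compare iso hi (Sw _ bi) hj (esym (block_start s0 bi)) (nesym ne).
have ne' : block s (start s (block s i)) <> block s j by rewrite block_start.
by have [_ ->] := isolating_compare iso hj (Sw _ bj) (Sw _ bi) (esym (block_start s0 bj)) ne'.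
Qed.

Lemma isolating_merge s w x y : isolating s w -> x < y <= size s ->
  isolated w (start s x) (start s y) ->
  exists2 s', isolating s' w & size s' = (size s - (y - x)).+1.
Proof.
move=> [s0 szw single] xy I.
set s' := take x s ++ (start s y - start s x) :: drop y s.
have lt_xy : start s x < start s y by rewrite start_lt.
have szx : size (take x s) = x by rewrite size_takel //; lia.
have szs' : size s' = (size s - (y - x)).+1.
  by rewrite size_cat /= szx size_drop; lia.
have startl q : q <= x -> start s' q = start s q.
  move=> qx; rewrite /start /s' take_cat szx;
    case: (ltngtP q x) qx => // [qx|->] _.
    by rewrite (take_takel _ (ltnW qx)).
  by rewrite subnn take0 cats0.
(* Blocks [x] to [y.-1] have become one, so later indices drop by [y - x - 1]. *)
have startr q : x < q -> start s' q = start s (q + y - x.+1).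
  move=> xq; rewrite {1}/start /s' take_cat szx ltnNge (ltnW xq) /=.
  rewrite sumn_cat -/(start s x) -[q - x]prednK ?subn_gt0 //= addnA subnKC 1?ltnW //.
  have -> : q + y - x.+1 = y + (q - x).-1 by lia.
  by rewrite /start takeD sumn_cat.
exists s' => //; split.
- rewrite mem_cat inE !negb_or eq_sym subn_eq0 -ltnNge lt_xy.
  by rewrite (contra (@mem_take _ _ _ _)) // (contra (@mem_drop _ _ _ _)).
- rewrite -start_size szs' startr; last lia.
  by rewrite -szw -[in RHS]start_size; congr start; lia.
move=> q; rewrite szs' => hq; case: (ltngtP q x) => qx.
- by rewrite !startl //; [apply: single; lia | exact: ltnW].
- rewrite !startr //; last exact: ltnW.
  have -> : q.+1 + y - x.+1 = (q + y - x.+1).+1 by lia.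
  apply: single; lia.
right; rewrite startl ?qx // startr //.
by have -> : x.+1 + y - x.+1 = y by lia.
Qed.

Lemma exists_simple_inflation w : cayley w -> 2 <= size w ->
  exists sigma alpha,
    [/\ simple_cayley sigma, 2 <= size sigma & inflates_to sigma alpha w].
Proof.
move=> cw w2.
suff coarsen n s : size s <= n -> isolating s w -> 2 <= size s ->
    exists sigma alpha,
    [/\ simple_cayley sigma, 2 <= size sigma & inflates_to sigma alpha w].
  (* Merging starts from the cutting into single positions. *)
  apply: (coarsen (size w) (nseq (size w) 1)); rewrite ?size_nseq //.
  split; first by rewrite mem_nseq andbF.
    by rewrite sumn_nseq mul1n.
  by move=> q; rewrite size_nseq => hq; left; rewrite startS nth_nseq hq addn1.
elim: n s => [|n IHn] s sn iso s2; first lia.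
have [sigma [alpha [cs infl Es]]] := isolating_inflates cw iso.
have pat := inflates_to_pattern cs infl; rewrite Es in pat.
have [szs _] := pat.
(* The first inequality makes the merge lower the number of blocks; the second leaves at least
   two. *)
case: (classic (exists x y, [/\ isolated sigma x y, x.+1 < y & y - x < size sigma])).
  case=> x [y [I xy yx]]; have [xyn _] := I.
  have I' := (isolated_pattern iso pat xyn).1 I.
  rewrite -szs in xyn yx; have [s' iso' szs'] := isolating_merge iso xyn I'.
  by apply: (IHn s'); rewrite // szs'; lia.
move=> none; exists sigma, alpha; split=> //; last by rewrite -szs.
split=> // a b hI; have I := (h_intervalE a b cs).1 hI; have [ab _] := I.
case: (ltngtP a b) => [ab'||]; [right|lia|by left].
have : ~ (b.+1 - a < size sigma).
  by move=> lt; apply: none; exists a, b.+1; split.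
lia.
Qed.

(** * Uniqueness *)

(** [sigma] is read off from the letters of [w] at the block starts. Within a block the offset is
    constant, so each component is the pattern of its block. *)
Lemma inflates_to_inj sigma sigma' alpha alpha' w :
  cayley sigma -> cayley sigma' ->
  inflates_to sigma alpha w -> inflates_to sigma' alpha' w ->
  shape alpha = shape alpha' -> sigma = sigma' /\ alpha = alpha'.
Proof.
move=> cs cs' infl infl' Es; set s := shape alpha in Es.
have [s0 szw _] := inflates_to_isolating cs infl.
have [szs pat] := inflates_to_pattern cs infl.
have [szs' pat'] := inflates_to_pattern cs' infl'.
rewrite -/s in s0 szw szs pat; rewrite -Es in szs' pat'.
split.
  apply: cayley_same_order_inj => //; split=> [|q r]; rewrite -szs // => hq hr.
  case: (eqVneq q r) => [->|/eqP ne]; first by rewrite !leqnn.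
  have S k : k < size s -> start s k < size w /\ block s (start s k) = k.
    by move=> hk; rewrite -szw start_lt_sumn // block_start.
  have [[lq bq] [lr br]] := (S q hq, S r hr).
  have := pat _ _ lq lr; have := pat' _ _ lq lr.
  by rewrite bq br => /(_ ne) <- /(_ ne) <-.
case: (infl) (infl') => -[sz H] wE [[sz' H'] wE'].
have nthE q x : x < nth 0 s q ->
    nth 0 w (start s q + x) =
      nth 0 (nth [::] alpha q) x + offset sigma alpha (nth 0 sigma q) /\
    nth 0 w (start s q + x) =
      nth 0 (nth [::] alpha' q) x + offset sigma' alpha' (nth 0 sigma' q).
  move=> hx; have := flatten_indexP hx; have := flatten_indexKl hx;
    have := flatten_indexKr hx.
  rewrite /flatten_index -/(start s q) => ro bl lt; split.
    by rewrite wE nth_inflation // ro bl.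
  by rewrite wE' nth_inflation -?Es // ro bl.
apply: (@eq_from_nth _ [::]) => [|q hq]; first by rewrite sz sz' -szs -szs'.
have hqs : q < size s by rewrite size_map.
apply: cayley_same_order_inj.
- by case: (H q) => //; rewrite -szs.
- by case: (H' q) => //; rewrite -szs'.
split=> [|x y]; first by rewrite -!nth_shape -/s Es.
rewrite -nth_shape -/s => hx hy.
have [h1 h1'] := nthE _ _ hx; have [h2 h2'] := nthE _ _ hy; lia.
Qed.

Lemma block_mono s i j : i <= j -> j < sumn s -> block s i <= block s j.
Proof.
move=> ij hj; have := block_bounds hj;
  have := block_bounds (leq_ltn_trans ij hj).
move=> bi bj; rewrite leqNgt; apply/negP => lt.
have := @start_le s _ _ lt; lia.
Qed.

Lemma blockS (s : seq nat) i :
  0 \notin s -> i.+1 < sumn s -> block s i.+1 <= (block s i).+1.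
Proof.
move=> s0 hi; have := block_bounds hi; have := block_bounds (ltnW hi).
move=> bi bi'; rewrite leqNgt; apply/negP => lt.
have := reshape_indexP hi => lt'.
have : start s (block s i).+1 < start s (block s i.+1)
  by rewrite start_lt // lt ltnW.
lia.
Qed.

Lemma block_cons a s i :
  block (a :: s) i = if i < a then 0 else (block s (i - a)).+1.
Proof.
rewrite /reshape_index /= subn_eq0; case: ltnP => // h; by rewrite subSn.
Qed.

(** If the first blocks had different lengths, position 0 and the first position after the shorter
    one would share a block in only one of the cuttings. *)
Lemma block_inj (s s' : seq nat) :
  0 \notin s -> 0 \notin s' -> sumn s = sumn s' ->
  (forall i j, i < sumn s -> j < sumn s ->
     block s i = block s j <-> block s' i = block s' j) ->
  s = s'.
Proof.
elim: s s' => [|a s IHs] [|a' s'] //=.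
- by rewrite inE negb_or => _ /andP[]; case: a'.
- by rewrite inE negb_or => /andP[]; case: a.
rewrite !inE !negb_or => /andP[a0 s0] /andP[a0' s0'] Esum same.
have Ea : a = a'.
  have [pa pa'] : 0 < a /\ 0 < a' by rewrite !lt0n eq_sym a0 eq_sym a0'.
  case: (ltngtP a a') => // lt.
    have [||_] := same 0 a; rewrite ?block_cons; [lia.. |].
    by rewrite pa pa' ltnn lt => /(_ erefl).
  have [||+ _] := same 0 a'; rewrite ?block_cons; [lia.. |].
  by rewrite pa pa' ltnn lt => /(_ erefl).
subst a'; congr (_ :: _); apply: IHs => //; first lia.
move=> i j hi hj; have := same (a + i) (a + j).
rewrite !block_cons ![_ + _ < a]ltnNge !leq_addr /= !addKn !ltn_add2l.
move=> /(_ hi hj) H.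
by split=> E; apply/succn_inj; apply/H; rewrite E.
Qed.

(* A proper interval meeting several blocks can be enlarged to a union of
   blocks, which is everything by simplicity; trimming one end block off then
   leaves an interval of [sigma] that is neither a point nor everything. *)
Lemma isolated_in_block sigma s w x y : simple_cayley sigma -> isolating s w ->
  pattern_along s sigma w -> 2 < size sigma -> isolated w x y ->
  ~ (x = 0 /\ y = size w) -> block s x = block s y.-1.
Proof.
move=> simp iso pat k3 I proper; case: (I) => xy _;
  case: (iso) => s0 szw single.
have [szs _] := pat.
have hx : x < sumn s by lia.
have hy : y.-1 < sumn s by lia.
have xy1 : x <= y.-1 by lia.
have := block_mono xy1 hy; set p := block s x; set q := block s y.-1.
case: (ltngtP p q) => // pq _.
have bx := block_bounds hx; have by_ := block_bounds hy;
  rewrite -/p -/q in bx by_.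
have qs : q < size s := reshape_indexP hy.
have pq1 : start s p.+1 <= start s q by exact: start_le.
(* Extends the interval down to a block start; a block of one position already starts at [x]. *)
have I1 : isolated w (start s p) y.
  case: (eqVneq (start s p) x) => [->//|ne].
  case: (single p) => [|E|Ip]; [lia | lia |]; apply: isolatedU Ip I _ _; lia.
have I2 : isolated w (start s p) (start s q.+1).
  case: (eqVneq (start s q.+1) y) => [->//|ne].
  case: (single q) => [|E|Iq]; [lia | lia |]; apply: isolatedU I1 Iq _ _; lia.
have le_pq : p < q.+1 <= size sigma by lia.
have [?|[p0 qk]] := simple_isolated simp ((isolated_pattern iso pat le_pq).2 I2); first lia.
have Sk : start s q.+1 = size w by rewrite qk -szs start_size.
have S0 : start s p = 0 by rewrite p0 start0.
(* Blocks 0 to [q] are now all of them. If [x = 0], then [y] lies strictly inside the last block,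
   and removing that block leaves at least two blocks but not all. *)
case: (posnP x) => x0.
  have Iq : isolated w (start s q) (start s q.+1)
    by case: (single q) => [//|E|//]; lia.
  have : isolated w (start s 0) (start s q).
    rewrite start0; move: I; rewrite x0 => I; apply: isolatedDl I Iq _ _; lia.
  have lt : 0 < q <= size sigma by lia.
  by case/(isolated_pattern iso pat lt).2/(simple_isolated simp) => [|[_]]; lia.
(* Here [x] lies strictly inside the first block, which is removed instead. *)
have Ip : isolated w (start s p) (start s p.+1) by case: (single p) => [|E|//];
  lia.
have I3 : isolated w (start s p.+1) y by apply: isolatedDr Ip I _ _; lia.
have I4 : isolated w (start s p.+1) (start s q.+1).
  case: (eqVneq (start s q.+1) y) => [->//|ne].
  case: (single q) => [//|E|Iq]; first lia; apply: isolatedU I3 Iq _ _; lia.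
have lt : p.+1 < q.+1 <= size sigma by lia.
by case: (simple_isolated simp ((isolated_pattern iso pat lt).2 I4)); lia.
Qed.

(** A block of [s'] is a single position or an H-interval, proper because [s'] has another block.
    Its two ends then share a block of [s], and so does everything between them. *)
Lemma block_coarsest sigma s s' w : simple_cayley sigma -> isolating s w ->
  pattern_along s sigma w -> 2 < size sigma -> isolating s' w -> 2 <= size s' ->
  forall i j, i < size w -> j < size w ->
  block s' i = block s' j -> block s i = block s j.
Proof.
move=> simp iso pat k3 [s0' szw' single'] k2' i j hi hj.
have [_ szw _] := iso.
wlog ij : i j hi hj / i <= j.
  by move=> H E; case: (leqP i j) => [/H|/ltnW/H]; [|move=> K; symmetry]; auto.
move=> E; rewrite -szw' in hi hj.
have := block_bounds hi; have := block_bounds hj; rewrite -E;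
  set q := block s' i => bj bi.
have qs : q < size s' := reshape_indexP hi.
case: (single' q qs) => [E1|Iq]; first by congr block; lia.
have Eq : block s (start s' q) = block s (start s' q.+1).-1.
  apply: (isolated_in_block simp iso pat k3 Iq); case=> S0 Sn.
  have q0 : q = 0.
    by rewrite -(block_start s0' qs) S0 -{1}(start0 s') block_start // ltnW.
  have : start s' q.+1 < start s' (size s') by rewrite start_lt //; lia.
  by rewrite start_size; lia.
have lt1 : (start s' q.+1).-1 < sumn s by case: Iq => ? _; lia.
have := @block_mono s (start s' q) i; have := @block_mono s i j.
have := @block_mono s j (start s' q.+1).-1; lia.
Qed.

(** The first and last positions always lie in different blocks, so [w] alone determines a [sigma]
    of length two. *)
Lemma inflates_to_ends sigma alpha w :
  cayley sigma -> inflates_to sigma alpha w -> size sigma = 2 ->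
  (nth 0 w 0 <= nth 0 w (size w).-1) = (nth 0 sigma 0 <= nth 0 sigma 1) /\
  (nth 0 w (size w).-1 <= nth 0 w 0) = (nth 0 sigma 1 <= nth 0 sigma 0).
Proof.
move=> cs infl k; have [s0 szw _] := inflates_to_isolating cs infl.
have [szs pat] := inflates_to_pattern cs infl.
set s := shape alpha in s0 szw szs pat; rewrite k in szs.
have w0 : 0 < size w by rewrite -szw -(start0 s) start_lt_sumn ?szs.
have B0 : block s 0 = 0 by rewrite -{1}(start0 s) block_start ?szs.
have B1 : block s (size w).-1 = 1.
  apply: block_eq; rewrite prednK // -szw -start_size szs leqnn andbT.
  have : start s 1 < start s 2 by rewrite start_lt ?szs.
  lia.
have lt : (size w).-1 < size w by rewrite prednK.
by rewrite !pat ?B0 ?B1.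
Qed.

Section TwoInflations.

Variables (sigma sigma' : seq nat) (alpha alpha' : seq (seq nat)) (w : seq nat).
Hypotheses (simp : simple_cayley sigma) (simp' : simple_cayley sigma').
Hypotheses (k2 : 2 <= size sigma) (k2' : 2 <= size sigma').
Hypotheses (infl : inflates_to sigma alpha w)
  (infl' : inflates_to sigma' alpha' w).

Let cs : cayley sigma. Proof. by case: simp. Qed.
Let cs' : cayley sigma'. Proof. by case: simp'. Qed.

(** If [sigma'] had length two, each of its two blocks would lie in one block of [sigma]. As
    consecutive positions advance by at most one block, [sigma] would have at most two. *)
Lemma simple_inflation_ge3 : 2 < size sigma ->
  2 < size sigma'.
Proof.
move=> k3; rewrite ltnNge; apply/negP => k2s'.
have iso := inflates_to_isolating cs infl;
  have iso' := inflates_to_isolating cs' infl'.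
have pat := inflates_to_pattern cs infl;
  have [szs' _] := inflates_to_pattern cs' infl'.
have [szs _] := pat.
have := block_coarsest simp iso pat k3 iso'; rewrite szs' => /(_ k2') co.
set s := shape alpha in iso pat szs co; set s' := shape alpha' in iso' szs' co.
case: iso iso' => s0 szw _ [s0' szw' _].
set c := start s' 1.
have c0 : 0 < c by rewrite -(start0 s') start_lt // szs'; lia.
have cn : c < size w by rewrite -szw' start_lt_sumn // szs'.
have S2 : start s' 2 = size w by rewrite -szw' -start_size szs'; congr start;
  lia.
have b0 i : i < c -> block s' i = 0 by move=> ic; apply: block_eq;
  rewrite start0.
have b1 i : c <= i < size w -> block s' i = 1 by move=> ic; apply: block_eq;
  rewrite S2.
have E0 := co 0 c.-1; have E1 := co c (size w).-1.
rewrite !b0 ?prednK // in E0; rewrite !b1 ?leqnn ?cn // in E1; try lia.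
have B0 : block s 0 = 0 by rewrite -{1}(start0 s) block_start //; lia.
have Bn : block s (size w).-1 = (size s).-1.
  apply: block_eq; rewrite [(size s).-1.+1]prednK; last lia.
  rewrite start_size szw;
    have : start s (size s).-1 < start s (size s) by rewrite start_lt //; lia.
  by rewrite start_size szw; lia.
have := @blockS s c.-1 s0; rewrite prednK // szw.
have := E0; have := E1; lia.
Qed.

(** Each of the two cuttings is coarser than the other. *)
Lemma simple_inflation_unique3 : 2 < size sigma ->
  sigma = sigma' /\ alpha = alpha'.
Proof.
move=> k3; have k3' := simple_inflation_ge3 k3.
have iso := inflates_to_isolating cs infl;
  have iso' := inflates_to_isolating cs' infl'.
have pat := inflates_to_pattern cs infl;
  have pat' := inflates_to_pattern cs' infl'.
have [szs _] := pat; have [szs' _] := pat'.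
apply: (inflates_to_inj cs cs' infl infl').
have [[s0 szw _] [s0' szw' _]] := (iso, iso').
apply: block_inj => //; first by rewrite szw szw'.
move=> i j; rewrite szw => hi hj; split.
  by apply: (block_coarsest simp' iso' pat' k3' iso); rewrite ?szs.
by apply: (block_coarsest simp iso pat k3 iso'); rewrite ?szs'.
Qed.

End TwoInflations.

Lemma simple_inflation_unique sigma sigma' alpha alpha' w :
  simple_cayley sigma -> simple_cayley sigma' ->
  2 <= size sigma -> 2 <= size sigma' ->
  inflates_to sigma alpha w -> inflates_to sigma' alpha' w -> sigma = sigma'.
Proof.
move=> simp simp' k2 k2' infl infl'.
case: (ltnP 2 (size sigma)) => k3.
  by have [] := simple_inflation_unique3 simp simp' k2 k2' infl infl' k3.
case: (ltnP 2 (size sigma')) => k3'.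
  by have [] := simple_inflation_unique3 simp' simp k2' k2 infl' infl k3'.
have [k k'] : size sigma = 2 /\ size sigma' = 2 by lia.
have [[cs _] [cs' _]] := (simp, simp').
have [e1 e2] := inflates_to_ends cs infl k;
  have [e1' e2'] := inflates_to_ends cs' infl' k'.
apply: cayley_same_order_inj => //; split=> [|i j]; rewrite k // => hi hj.
case: i hi => [|[|//]] _; case: j hj => [|[|//]] _; lia.
Qed.

(** * Inflations of 12 and 21 *)

Lemma cayley12 : cayley [:: 1; 2]. Proof. by exists 2. Qed.

Lemma cayley21 : cayley [:: 2; 1].
Proof. by exists 2 => // v; rewrite !inE orbC. Qed.

Lemma cayley11 : cayley [:: 1; 1].
Proof. by exists 1 => // v; rewrite !inE orbb. Qed.

(** Isolates 11 as the only pattern of length two other than 12 and 21. *)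
Lemma cayley_size2 sigma : cayley sigma -> size sigma = 2 ->
  [\/ sigma = [:: 1; 1], sigma = [:: 1; 2] | sigma = [:: 2; 1]].
Proof.
case: sigma => [|a [|b []]] // cs _.
have so u v : ((u <= v) = (a <= b)) -> ((v <= u) = (b <= a)) ->
    same_order [:: a; b] [:: u; v].
  by move=> ab ba; split=> // -[|[|//]] [|[|//]] _ _ //=; rewrite !leqnn.
case: (ltngtP a b) => ab.
- apply: Or32; apply: cayley_same_order_inj (cs) cayley12 (so _ _ _ _); lia.
- apply: Or33; apply: cayley_same_order_inj (cs) cayley21 (so _ _ _ _); lia.
- apply: Or31; apply: cayley_same_order_inj (cs) cayley11 (so _ _ _ _); lia.
Qed.

Section TwoBlocks.

Variables (tau : seq nat).
Hypotheses (tau_cayley : cayley tau) (size_tau : size tau = 2).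
Hypothesis tau_inj : nth 0 tau 0 <> nth 0 tau 1.

(* Convertible to [plus_indecomposable] for tau = 12 and to
   [minus_indecomposable] for tau = 21. *)
Definition indecomposable (w : seq nat) : Prop :=
  ~ exists a b, [/\ cayley a, cayley b, size a < size w, size b < size w
                  & w = inflation tau [:: a; b]].

(** For [tau] = 12 the letters before [c] are all smaller than those from [c] on; for 21 they are
    all larger. *)
Definition cut (w : seq nat) (c : nat) : Prop :=
  0 < c < size w /\
  forall i j, i < c -> c <= j < size w ->
    (nth 0 w i <= nth 0 w j) = (nth 0 tau 0 <= nth 0 tau 1) /\
    (nth 0 w j <= nth 0 w i) = (nth 0 tau 1 <= nth 0 tau 0).

Lemma cut_isolating w c : cut w c -> isolating [:: c; size w - c] w.
Proof.
case=> hc cmp; split=> [||q] /=; first by rewrite !inE !negb_or; lia.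
  lia.
case: q => [|[|//]] _; right; rewrite /start /= ?take0 /= ?addn0 ?subnKC;
  try lia.
  split=> [|i i' j hi hi' hj nj]; first lia.
  have := cmp i j; have := cmp i' j; move: tau_inj; lia.
split=> [|i i' j hi hi' hj nj]; first lia.
have := cmp j i; have := cmp j i'; move: tau_inj; lia.
Qed.

Lemma cut_inflates w c : cayley w -> cut w c ->
  exists2 alpha, inflates_to tau alpha w & shape alpha = [:: c; size w - c].
Proof.
move=> cw hc;
  have [sigma [alpha [cs infl Es]]] := isolating_inflates cw (cut_isolating hc).
have [szs _] := inflates_to_pattern cs infl; rewrite Es /= in szs.
have [e1 e2] := inflates_to_ends cs infl (esym szs).
(* The end letters of [w] lie on both sides of the cut, which identifies the pattern of the two
   blocks as [tau]. *)
case: hc => hc cmp; have [] := cmp 0 (size w).-1; [lia|lia|];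
  rewrite e1 e2 => f1 f2.
exists alpha => //; suff <- : sigma = tau by [].
apply: cayley_same_order_inj => //; split=> [|i j]; rewrite -szs // => hi hj.
by case: i hi => [|[|//]] _; case: j hj => [|[|//]] _; rewrite ?leqnn.
Qed.

Lemma inflates_cut w alpha : inflates_to tau alpha w ->
  cut w (size (nth [::] alpha 0)) /\
  shape alpha = [:: size (nth [::] alpha 0); size w - size (nth [::] alpha 0)].
Proof.
move=> infl; have [s0 szw _] := inflates_to_isolating tau_cayley infl.
have [szs pat] := inflates_to_pattern tau_cayley infl.
rewrite size_tau in szs; rewrite -nth_shape.
case: (shape alpha) s0 szw szs pat => [|a [|b []]] //= s0 szw _ pat.
rewrite !inE !negb_or in s0; have [a0 b0] : 0 < a /\ 0 < b by lia.
split; last by congr [:: _; _]; lia.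
split=> [|i j hi hj]; first lia.
have bi : block [:: a; b] i = 0 by apply: block_eq; rewrite /start /= addn0.
have bj : block [:: a; b] j = 1 by apply: block_eq; rewrite /start /=; lia.
by rewrite !pat ?bi ?bj //; lia.
Qed.

Lemma decomposableP w : cayley w ->
  (exists a b, [/\ cayley a, cayley b, size a < size w, size b < size w
                & w = inflation tau [:: a; b]]) <-> exists c, cut w c.
Proof.
move=> cw; split=> [[a [b [ca cb la lb Ew]]]|[c hc]].
  have szw : size w = size a + size b
    by rewrite Ew size_inflation ?size_tau //= addn0.
  suff infl : inflates_to tau [:: a; b] w.
    by exists (size a); have [] := inflates_cut infl.
  split=> //; split=> [|i]; first by rewrite size_tau.
  rewrite size_tau => hi; split; [by case: i hi => [|[|]]| |].
    by case: i hi => [|[|]] //= _ E; move: szw la lb; rewrite E /=; lia.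
  (* The two letters of [tau] differ, so the restriction on repeated letters is vacuous. *)
  case/count_mem_gt1 => [|j [hj ji E]]; first by rewrite size_tau.
  rewrite size_tau in hj; by case: tau_inj;
    case: i j hi hj ji E => [|[|//]] [|[|//]].
have [alpha infl Es] := cut_inflates cw hc.
case: (infl) hc => -[sz H] Ew [hc _];
  case: alpha sz H Ew Es {infl} => [|a [|b []]] //= _ H Ew [Ea Eb].
rewrite size_tau in H; exists a, b; split=> //; try lia.
- by case: (H 0).
- by case: (H 1).
Qed.

(** The first block of [w] is the first component shifted by a constant, and the given inflation
    already compares that block correctly with the later positions. *)
Lemma cut_first w alpha c :
  inflates_to tau alpha w -> c < size (nth [::] alpha 0) ->
  cut w c <-> cut (nth [::] alpha 0) c.
Proof.
move=> infl hc; have [[hn cmp] Es] := inflates_cut infl.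
have wE i : i < size (nth [::] alpha 0) ->
    nth 0 w i = nth 0 (nth [::] alpha 0) i + offset tau alpha (nth 0 tau 0).
  case: (infl) => -[sz _] Ew hi; rewrite {1}Ew nth_inflation //; last first.
    by rewrite Es /= addn0 subnKC; lia.
  rewrite (_ : block _ i = 0); last by apply: block_eq;
    rewrite /start Es /= addn0.
  by rewrite /reshape_offset (_ : block _ i = 0) ?take0 ?subn0 //;
    apply: block_eq; rewrite /start Es /= addn0.
split=> [[c0 H]|[c0 H]]; split; try lia.
  move=> i j hi hj; have := H i j hi; rewrite !wE ?leq_add2r; [|lia|lia].
  by apply; lia.
move=> i j hi hj; case: (ltnP j (size (nth [::] alpha 0))) => hj';
  last by apply: cmp; lia.
by rewrite !wE ?leq_add2r //; [apply: H => //; lia | lia].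
Qed.

(** A cut of the first component would be a smaller cut of [w], so the least cut point works. At any
    larger cut point, the least one cuts the first component. *)
Lemma unique_two_block_inflation w :
  cayley w -> (exists alpha, inflates_to tau alpha w) ->
  exists! alpha, inflates_to tau alpha w /\ indecomposable (nth [::] alpha 0).
Proof.
move=> cw [alpha0 infl0].
have first_cayley alpha : inflates_to tau alpha w -> cayley (nth [::] alpha 0).
  by case=> -[_ H] _; case: (H 0); rewrite ?size_tau.
have [c [hc c_min]] : exists c, cut w c /\ forall c', c' < c -> ~ cut w c'.
  have [] := inflates_cut infl0; move: (size _) => c + _.
  elim/ltn_ind: c => c IHc hc.
  case: (classic (exists2 c', c' < c & cut w c')) => [[c' lt hc']|none].
    exact: IHc lt hc'.
  by exists c; split=> // c' lt hc'; apply: none; exists c'.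
have [alpha infl Es] := cut_inflates cw hc.
have szc : size (nth [::] alpha 0) = c by rewrite -nth_shape Es.
exists alpha; split=> [|alpha' [infl' ind']].
  split=> //; case/(decomposableP (first_cayley _ infl)) => c' hc'.
  have lt : c' < size (nth [::] alpha 0) by case: hc'; lia.
  by apply: (c_min c'); [rewrite -szc | apply/(cut_first infl lt)].
have [hc' Es'] := inflates_cut infl'.
suff E : size (nth [::] alpha' 0) = c.
  have Eshape : shape alpha = shape alpha' by rewrite Es Es' E.
  by have [] := inflates_to_inj tau_cayley tau_cayley infl infl' Eshape.
apply/eqP; rewrite eqn_leq [_ <= _]leqNgt [c <= _]leqNgt; apply/andP; split;
  apply/negP => lt.
  by apply: ind'; apply/(decomposableP (first_cayley _ infl')); exists c;
    apply/(cut_first infl' lt).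
exact: (c_min _ lt).
Qed.

End TwoBlocks.

Theorem theorem3p4 (w : seq nat) (w_cayley : cayley w) (w_ge2 : 2 <= size w) :
  exists sigma : seq nat,
    unique
      (fun s => [/\ simple_cayley s, 2 <= size s
                  & exists alpha, inflates_to s alpha w])
      sigma /\
    [/\ sigma <> [:: 1; 2] -> sigma <> [:: 2; 1] ->
          exists! alpha, inflates_to sigma alpha w,
        sigma = [:: 1; 2] ->
          exists! alpha, inflates_to sigma alpha w /\
                         plus_indecomposable (nth [::] alpha 0)
      & sigma = [:: 2; 1] ->
          exists! alpha, inflates_to sigma alpha w /\
                         minus_indecomposable (nth [::] alpha 0)].
Proof.
have [sigma [alpha [simp k2 infl]]] := exists_simple_inflation w_cayley w_ge2.
exists sigma; split.
  split=> [|sigma' [simp' k2' [alpha' infl']]]; first by split=> //;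
    exists alpha.
  exact: simple_inflation_unique simp simp' k2 k2' infl infl'.
split=> [n12 n21|E|E]; last first.
- by subst sigma; apply: (@unique_two_block_inflation [:: 2; 1]) => //;
  [exact: cayley21 | exists alpha].
- by subst sigma; apply: (@unique_two_block_inflation [:: 1; 2]) => //;
  [exact: cayley12 | exists alpha].
exists alpha; split=> // alpha' infl'.
case: (ltnP 2 (size sigma)) => k3.
  by have [] := simple_inflation_unique3 simp simp k2 k2 infl infl' k3.
have k : size sigma = 2 by lia.
have [E|//|//] := cayley_size2 (proj1 simp) k.
(* Only [sigma] = 11 remains; its repeated letter forces both components. *)
have ones beta : inflates_to sigma beta w -> beta = [:: [:: 1]; [:: 1]].
  rewrite E => -[[sz H] _]; case: beta sz H => [|a [|b []]] //= _ H.
  have [_ _ /= Ea] := H 0 isT; have [_ _ /= Eb] := H 1 isT.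
  by rewrite Ea // Eb.
by rewrite (ones _ infl) (ones _ infl').
Qed.
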